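(* Let $k\ge 1$ and let $G$ be a locally symmetric graph with vertex set $\mathbb{Z}^k$. Then the minimum edge-boundary is a monotonically increasing function of the volume: writing $f_G(n)=\min\{|\partial A| : A\subset \mathbb{Z}^k,\ |A|=n\}$, one has $f_G(n)\le f_G(n+1)$ for every $n\in\mathbb{N}$.
   Context: Graphs are simple and undirected. For a graph $G=(V(G),E(G))$ and a finite $A\subset V(G)$, the edge boundary of $A$ is $\partial A=\{e\in E(G): e=\{v,a\}\text{ for some } a\in A \text{ and } v\in V(G)\setminus A\}$, and $|\partial A|$ is its cardinality. The volume of $A$ is $|A|$. The neighbourhood of $x$ is $N_G(x)=\{y\in V(G):\{x,y\}\in E(G)\}$. A graph $G$ with vertex set $\mathbb{Z}^k$ is locally symmetric if for every $x\in \mathbb{Z}^k$ the neighbourhood $N_G(x)$ is centrally symmetric about $x$, i.e. $y\in N_G(x)$ implies $2x-y\in N_G(x)$. ''Monotonically increasing'' is meant in the weak sense (non-decreasing). *)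

(* Defs.v *)
From mathcomp Require Import all_boot all_order all_algebra finmap.
From mathcomp Require Import boolp classical_sets cardinality constructive_ereal.

Set Implicit Arguments.
Unset Strict Implicit.
Unset Printing Implicit Defensive.

Import Order.TTheory GRing.Theory Num.Theory.

Local Open Scope fset_scope.
Local Open Scope classical_set_scope.
Local Open Scope ring_scope.

(* Since every edge has exactly two elements there are no loops, and since     *)
(* edges form a set there are no multiple edges.  Vertices may have infinite   *)
(* degree.                                                                     *)
Record graph (V : choiceType) := Graph {
  edges : set {fset V};
  edges_card2 : forall e : {fset V}, edges e -> #|` e| = 2%N }.

Definition neighbourhood (V : choiceType) (G : graph V) (x : V) : set V :=
  [set y | edges G [fset x; y]%fset].

Definition edge_boundary (V : choiceType) (G : graph V) (A : {fset V}) :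
    set {fset V} :=
  [set e | edges G e /\
     exists a v : V, [/\ a \in A, v \notin A & e = [fset v; a]%fset]].

(* Cardinality with values in {0, 1, 2, ..., +oo}.  For sets of edges of  *)
(* a graph on a countable vertex set this loses no information, all infinite   *)
(* cardinalities being equal.                                                  *)
Definition ecard (T : choiceType) (S : set T) : \bar int :=
  if `[< finite_set S >] then (#|` fset_set S|%:Z)%:E else +oo%E.

Definition boundary_sizes (V : choiceType) (G : graph V) (n : nat) :
    set (\bar int) :=
  [set ecard (edge_boundary G A) | A in [set A : {fset V} | #|` A| = n]].

(* The least element of boundary_sizes G n.  It exists as soon as V has a      *)
(* subset with n elements (min_edge_boundaryP); otherwise the value is the     *)
(* default +oo.                                                                *)
Definition min_edge_boundary (V : choiceType) (G : graph V) (n : nat) :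
    \bar int :=
  xget +oo%E (boundary_sizes G n `&` lbound (boundary_sizes G n)).

Lemma ecardP (T : choiceType) (S : set T) :
  ecard S = +oo%E \/ exists m : nat, ecard S = (m%:Z)%:E.
Proof.
rewrite /ecard; case: ifP => _; last by left.
by right; exists #|` fset_set S|.
Qed.

Lemma min_edge_boundaryP (V : choiceType) (G : graph V) (A0 : {fset V}) :
  let S := boundary_sizes G #|` A0| in
  S (min_edge_boundary G #|` A0|) /\ lbound S (min_edge_boundary G #|` A0|).
Proof.
move=> S; suff /(xgetPex +oo%E) : exists m, (S `&` lbound S) m by [].
have [[m0 Sm0]|noS] := pselect (exists m : nat, S (m%:Z)%:E).
  have exm : exists m : nat, `[< S (m%:Z)%:E >] by exists m0; apply/asboolP.
  case: (ex_minnP exm) => m /asboolP Sm min_m.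
  exists (m%:Z)%:E; split=> // x Sx.
  have [A _ Ax] := Sx; case: (ecardP (edge_boundary G A)) => [AE|[j AE]].
    by rewrite -Ax AE leey.
  rewrite -Ax AE lee_fin lez_nat; apply: min_m; apply/asboolP.
  by rewrite -AE Ax.
exists +oo%E; split.
  exists A0 => //; case: (ecardP (edge_boundary G A0)) => // -[j AE].
  by case: noS; exists j; exists A0.
move=> x [A cA <-]; case: (ecardP (edge_boundary G A)) => [->//|[j AE]].
by case: noS; exists j; exists A.
Qed.

Definition locally_symmetric (k : nat) (G : graph 'rV[int]_k) : Prop :=
  forall x y : 'rV[int]_k,
    neighbourhood G x y -> neighbourhood G x (x *+ 2 - y).

(* Main.v *)
Require Import Defs.
From mathcomp Require Import all_boot all_order all_algebra finmap.
From mathcomp Require Import boolp classical_sets cardinality constructive_ereal.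
From mathcomp Require Import ring.

(** Let [A] be a set of [n + 1] vertices with smallest edge boundary.  It is
    enough to find a point [x] of [A] whose removal does not enlarge the
    boundary.  Take [x] of maximal Euclidean norm in [A].  By the parallelogram
    law (strict convexity of the ball) [x] is not the midpoint of two other
    points of [A] ([exists_non_midpoint]).

    Removing [x] destroys the boundary edges from [x] to the outside of [A] and
    creates the boundary edges [{x, a}] with [a] in [A].  Since [G] is invariant
    under the reflection [y |-> 2x - y] on the neighbours of [x], and since this
    reflection sends the points [a <> x] of [A] outside of [A], each created edge
    [{x, a}] is paired with the destroyed edge [{x, 2x - a}].  The pairing is
    written as one injection [swing x] from the new boundary into the old one,
    the identity on the edges that avoid [x], so that vertices of infinite
    degree need no separate counting ([ecard_boundary_remove]). *)

Set Implicit Arguments.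
Unset Strict Implicit.
Unset Printing Implicit Defensive.

Import Order.TTheory GRing.Theory Num.Theory.

Local Open Scope classical_set_scope.
Local Open Scope fset_scope.
Local Open Scope ring_scope.

Lemma ecard_le_inj (T U : choiceType) (f : T -> U) (S : set T) (S' : set U) :
  injective f -> (forall s, S s -> S' (f s)) -> (ecard S <= ecard S')%E.
Proof.
move=> f_inj fSS'; have fS_sub : (f @` S `<=` S')%classic by move=> _ [s /fSS' ? <-].
have fS_card : ((f @` S)%classic #= S)%card.
  by apply: inj_card_eq => s t _ _; apply: f_inj.
rewrite /ecard; case: (asboolP (finite_set S')) => [finS'|_]; last exact: leey.
have finS : finite_set S.
  by rewrite -(eq_finite_set fS_card); apply: sub_finite_set finS'.
case: asboolP => // _; rewrite lee_fin lez_nat.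
have <- : #|` fset_set (f @` S)%classic| = #|` fset_set S|.
  by rewrite fset_set_image // card_imfset.
apply: fsubset_leq_card; rewrite -fset_set_sub //.
by rewrite (eq_finite_set fS_card).
Qed.

Section ExtremePoint.
Variable k : nat.
Implicit Types x y : 'rV[int]_k.

Definition sqnorm x : int := \sum_i x 0 i ^+ 2.

Lemma sqnorm_gt0 x : x != 0 -> 0 < sqnorm x.
Proof.
move=> x_neq0; rewrite lt0r sumr_ge0 ?andbT; last by move=> i _; apply: sqr_ge0.
apply: contraNneq x_neq0 => sqx0; apply/eqP/rowP => i; rewrite mxE.
have := psumr_eq0P (fun i _ => sqr_ge0 (x 0 i)) sqx0.
by move=> /(_ i isT) /eqP; rewrite sqrf_eq0 => /eqP.
Qed.

Lemma parallelogram x y :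
  sqnorm (x *+ 2 - y) + sqnorm y = sqnorm x *+ 2 + sqnorm (x - y) *+ 2.
Proof.
rewrite /sqnorm -!sumrMnl -!big_split /=; apply: eq_bigr => i _.
by rewrite mulr2n !mxE; ring.
Qed.

(** At a point [x] of maximal norm, having both [a] and [2x - a] in [A] would
    bound the left-hand side of the parallelogram law by [2 |x|^2], forcing
    [|x - a|^2 <= 0]. *)
Lemma exists_non_midpoint (A : {fset 'rV[int]_k}) : A != fset0 ->
  exists2 x, x \in A & forall a, a \in A -> a != x -> x *+ 2 - a \notin A.
Proof.
case/fset0Pn => x0 Ax0.
case: (@arg_maxP _ _ A [` Ax0] predT (fun z => sqnorm (val z)) isT) => x _ x_max.
exists (val x); first exact: valP.
move=> a Aa a_neqx; apply/negP => Ara.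
have a_le : sqnorm a <= sqnorm (val x) by apply: (x_max [` Aa]).
have ra_le : sqnorm (val x *+ 2 - a) <= sqnorm (val x) by apply: (x_max [` Ara]).
have d_gt0 : 0 < sqnorm (val x - a).
  by apply: sqnorm_gt0; rewrite subr_eq0 eq_sym.
have := lerD ra_le a_le; rewrite parallelogram -mulr2n gerDl leNgt.
by rewrite pmulrn_lgt0 ?d_gt0.
Qed.

End ExtremePoint.

Section Removal.
Variables (k : nat) (G : graph 'rV[int]_k).
Implicit Types (x y : 'rV[int]_k) (e : {fset 'rV[int]_k}).

Definition point_reflection x y := x *+ 2 - y.

Lemma point_reflectionK x : involutive (point_reflection x).
Proof. by move=> y; rewrite /point_reflection opprB addrC subrK. Qed.

Lemma point_reflection_center x : point_reflection x x = x.
Proof. by rewrite /point_reflection mulr2n addrK. Qed.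

(** Only the edges at [x] are reflected: the others belong to the boundary of
    [A] if and only if they belong to that of [A] without [x]. *)
Definition swing x e :=
  if x \in e then [fset point_reflection x y | y in e] else e.

Lemma in_imfset_point_reflection x y e :
  (y \in [fset point_reflection x z | z in e]) =
  (point_reflection x y \in e).
Proof.
rewrite -{1}(point_reflectionK x y) mem_imfset //=.
exact: inv_inj (point_reflectionK x).
Qed.

(** The centre is fixed, so [swing x e] contains [x] exactly when [e] does, and
    [swing x] is an involution. *)
Lemma swing_inj x : injective (swing x).
Proof.
apply: inv_inj => e; rewrite /swing; case: (boolP (x \in e)) => [xe|/negbTE->//].
rewrite in_imfset_point_reflection point_reflection_center xe.
by apply/fsetP => y; rewrite !in_imfset_point_reflection point_reflectionK.
Qed.

Lemma swing_edge x a : swing x [fset x; a] = [fset x; x *+ 2 - a].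
Proof.
rewrite /swing !inE eqxx /=; apply/fsetP => y.
rewrite in_imfset_point_reflection !inE.
by rewrite !(inv_eq (point_reflectionK x)) point_reflection_center.
Qed.

Lemma ecard_boundary_remove (A : {fset 'rV[int]_k}) x :
  locally_symmetric G -> x \in A ->
  (forall a, a \in A -> a != x -> x *+ 2 - a \notin A) ->
  (ecard (edge_boundary G (A `\ x)) <= ecard (edge_boundary G A))%E.
Proof.
move=> symG Ax x_ext; apply: (ecard_le_inj (@swing_inj x)).
move=> e [Ge [a [v [Ba Bv eE]]]]; rewrite {e}eE in Ge *.
move: Ba Bv; rewrite !inE => /andP[a_neqx Aa].
have [v_eqx _|v_neqx /= vA] := eqVneq v x.
  rewrite v_eqx in Ge *.
  rewrite swing_edge; split; first exact: symG.
  exists x, (x *+ 2 - a); split=> //; first exact: x_ext.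
  by rewrite fsetUC.
rewrite /swing !inE ![x == _]eq_sym (negbTE v_neqx) (negbTE a_neqx) /=.
by split=> //; exists a, v.
Qed.

End Removal.

Theorem theorem1 (k : nat) (hk : (0 < k)%N) (G : graph 'rV[int]_k)
    (hG : locally_symmetric G) (n : nat) :
  (min_edge_boundary G n <= min_edge_boundary G n.+1)%E.
Proof.
rewrite {2}/min_edge_boundary; case: xgetP => [_ _ [[A Acard <-] _]|_]; last first.
  (* Without a minimizer the right-hand side is the default value [+oo]. *)
  exact: leey.
have A_neq0 : A != fset0 by rewrite -cardfs_gt0 Acard.
have [x Ax x_ext] := exists_non_midpoint A_neq0.
have Bcard : #|` A `\ x| = n.
  by move: Acard; rewrite /= (cardfsD1 x) Ax => -[].
apply: le_trans (ecard_boundary_remove hG Ax x_ext).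
have [_] := min_edge_boundaryP G (A `\ x); rewrite Bcard; apply.
by exists (A `\ x).
Qed.
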